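(* Let $\hat S_0=\bigcap_{\nu<0}S_\nu$. Then: (i) the set of all $g\in\hat S_0$ such that $$\Big|\Big\{e^{i\theta}\in\mathbb T:\limsup_{r\to1}|g(re^{i\theta})|=\infty\Big\}\Big|=1$$ is residual in $\hat S_0$; and therefore (ii) $H^2=S_0$ is a first category subset of $\hat S_0$.
   Context: $\mathbb D$ is the open unit disc in $\mathbb C$ and $\mathbb T$ the unit circle; $|F|$ denotes the normalized Lebesgue measure of a measurable set $F\subset\mathbb T$ (so $|\mathbb T|=1$). For $\nu\in\mathbb R$, $S_\nu$ is the Hilbert space of analytic functions $f(z)=\sum_{n=0}^\infty a_nz^n$ on $\mathbb D$ with $$\|f\|_{S_\nu}=\Big(\sum_{n=0}^\infty|a_n|^2(n+1)^{2\nu}\Big)^{1/2}<\infty.$$ For $\nu=0$ this is the classical Hardy space $H^2$. The space $\hat S_0$ is a complete metric space with a metric coming from the countable family of norms $\|\cdot\|_{S_{\nu_k}}$, where $(\nu_k)$ is a sequence with $\nu_k<0$ for all $k$ and $\lim_{k\to\infty}\nu_k=0$ (i.e. the topology of $\hat S_0$ is the one generated by these norms: $g_j\to g$ iff $\|g_j-g\|_{S_{\nu_k}}\to0$ for every $k$). Limits $r\to1$ are taken with $r<1$. A residual set is a set containing a dense $G_\delta$ set; a first category set is a countable union of nowhere dense sets. *)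

(* Defs.v *)
From HB Require Import structures.
From mathcomp Require Import all_boot all_order all_algebra.
From mathcomp Require Import all_classical all_reals all_analysis.
From mathcomp Require Import borel_hierarchy complex.

Set Implicit Arguments.
Unset Strict Implicit.
Unset Printing Implicit Defensive.

Import Order.TTheory GRing.Theory Num.Theory.
Import numFieldNormedType.Exports.

Local Open Scope classical_set_scope.
Local Open Scope ring_scope.
Local Open Scope complex_scope.

Section Topology.
Context {T : topologicalType}.
Implicit Type A : set T.

Definition residual A := exists2 B, Gdelta B /\ dense B & B `<=` A.

Definition nowhere_dense A := (closure A)° = set0.

Definition first_category A :=
  exists2 F : (set T)^nat, (forall i, nowhere_dense (F i)) & A = \bigcup_i F i.

End Topology.

Section Spaces.
Context {R : realType}.
Implicit Types (f : R[i] -> R[i]) (a : nat -> R[i]) (nu : R).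

(* The modulus with values in R; `|z| has values in R[i]. *)
Definition cmod (z : R[i]) : R := ComplexField.Normc.normc z.

Definition expi (t : R) : R[i] := cos t +i* sin t.

Definition circle : set R[i] := [set w | cmod w = 1].

(* Normalized Lebesgue measure of a subset of the unit circle, through the
   parametrization t |-> e^{it} of the circle by [0, 2 pi[. *)
Definition circle_measure (F : set R[i]) : \bar R :=
  (((2 * pi)^-1)%:E *
   lebesgue_measure [set t : R | (0 <= t < 2 * pi)%R /\ F (expi t)])%E.

Definition power_series_on_disc f a :=
  forall z : R[i], cmod z < 1 ->
    (\sum_(0 <= n < N) a n * z ^+ n : R[i]^o) @[N --> \oo] --> (f z : R[i]^o).

(* Functions on the open unit disc are encoded as functions on R[i] that vanish
   off the disc, so that equality is equality on the disc. *)
Definition analytic_on_disc f :=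
  (forall z, 1 <= cmod z -> f z = 0) /\ exists a, power_series_on_disc f a.

(* The coefficients of f are unique when f is analytic; the default value is
   never used in that case. *)
Definition taylor_coef f : nat -> R[i] :=
  xget (fun=> 0) [set a | power_series_on_disc f a].

Definition norm_S nu f : \bar R :=
  sqrte (\sum_(0 <= n <oo)
    (cmod (taylor_coef f n) ^+ 2 * (n.+1%:R `^ (2 * nu)))%:E)%E.

Definition space_S nu : set (R[i] -> R[i]) :=
  [set f | analytic_on_disc f /\ (norm_S nu f < +oo)%E].

Definition hatS0 : set (R[i] -> R[i]) :=
  \bigcap_(nu in [set nu : R | nu < 0]) space_S nu.

(* The sequence [nu] does not affect the carrier, only the topology. *)
Definition hatS0_type (nu : nat -> R) : Type := set_type hatS0.

Definition hatS0_fun (nu : nat -> R) (g : hatS0_type nu) : R[i] -> R[i] :=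
  val (g : set_type hatS0).

Definition hatS0_ball (nu : nat -> R) (k : nat) (g : hatS0_type nu) (e : R) :
    set (hatS0_type nu) :=
  [set h | (norm_S (nu k) (hatS0_fun h \- hatS0_fun g)%R < e%:E)%E].

HB.instance Definition _ (nu : nat -> R) :=
  Choice.copy (hatS0_type nu) (set_type hatS0).

(* The topology generated by the norms norm_S (nu k): the balls of these norms
   form a subbase. *)
HB.instance Definition _ (nu : nat -> R) :=
  @isSubBaseTopological.Build (hatS0_type nu) (set (hatS0_type nu))
    [set U | exists k g e, 0 < e /\ U = hatS0_ball k g e] id.

Definition radial_limsup_infinite (g : R[i] -> R[i]) : set R[i] :=
  [set w | circle w /\
    limf_esup (fun r : R => (cmod (g (r%:C * w)))%:E) 1^'- = +oo%E].

End Spaces.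

(* Main.v *)
(* The function h = sum_k 4^k z^(64^(k^2)) has gaps so wide that, on the circle
   of radius 1 - 1/(2 * 64^(k^2)), the k-th term dominates the sum of all the
   others; so min_{|z| = r} |h(z)| is unbounded as r -> 1. It lies in every
   S_nu with nu < 0, but not in S_0, its coefficients being unbounded. Replacing
   the tail of the coefficients of any g by that of h gives functions that
   converge to g, and that differ from h by a polynomial. So the G_delta set of
   the g with min_{|z| = r} |g(z)| unbounded as r -> 1 is dense, without any
   completeness argument, and all its elements have an infinite radial limsup at
   every point of the circle. The same functions show that the S_0-balls, on
   which each coefficient is bounded by the radius, are nowhere dense. *)
Require Import Defs.
From HB Require Import structures.
From mathcomp Require Import all_boot all_order all_algebra.
From mathcomp Require Import all_classical all_reals all_analysis.
From mathcomp Require Import borel_hierarchy complex.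
From mathcomp Require Import finmap ring lra zify.

Set Implicit Arguments.
Unset Strict Implicit.
Unset Printing Implicit Defensive.

Import Order.TTheory GRing.Theory Num.Theory.
Import numFieldNormedType.Exports.

Local Open Scope classical_set_scope.
Local Open Scope ring_scope.

(** * The real-valued modulus and complex limits *)

Section Modulus.
Context {R : realType}.
Implicit Types (z w : R[i]) (u v : nat -> R[i]) (r : R).

Lemma normC_cmod z : `|z| = (cmod z)%:C%C.
Proof. by []. Qed.

Lemma cmod_ge0 z : 0 <= cmod z.
Proof. by case: z => a b; exact: sqrtr_ge0. Qed.

Lemma cmod0 : cmod (0 : R[i]) = 0.
Proof. exact: ComplexField.Normc.normc0. Qed.

Lemma cmod_eq0 z : cmod z = 0 -> z = 0.
Proof. exact: ComplexField.Normc.eq0_normc. Qed.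

Lemma cmodM z w : cmod (z * w) = cmod z * cmod w.
Proof. exact: ComplexField.Normc.normcM. Qed.

Lemma cmodX z n : cmod (z ^+ n) = cmod z ^+ n.
Proof.
elim: n => [|n IH]; first exact: ComplexField.Normc.normc1.
by rewrite !exprS cmodM IH.
Qed.

Lemma ler_cmodD z w : cmod (z + w) <= cmod z + cmod w.
Proof. exact: le_normcD. Qed.

Lemma cmodN z : cmod (- z) = cmod z.
Proof. exact: (normcN (z : Rcomplex R)). Qed.

Lemma ler_cmodB z w : cmod (z - w) <= cmod z + cmod w.
Proof. by rewrite -[cmod w]cmodN ler_cmodD. Qed.

Lemma lerB_cmodD z w : cmod z - cmod w <= cmod (z + w).
Proof. by rewrite lerBlDr -{1}[z](addrK w) ler_cmodB. Qed.

Lemma cmod_distC z w : cmod (z - w) = cmod (w - z).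
Proof. by rewrite -cmodN opprB. Qed.

Lemma ler_cmod_sum (I : Type) (s : seq I) (P : pred I) (F : I -> R[i]) :
  cmod (\sum_(i <- s | P i) F i) <= \sum_(i <- s | P i) cmod (F i).
Proof.
elim/big_rec2: _ => [|i x y _ IH]; first by rewrite cmod0.
by apply: le_trans (ler_cmodD _ _) _; rewrite lerD2l.
Qed.

Lemma cmod_real r : 0 <= r -> cmod r%:C%C = r.
Proof. by move=> r0; rewrite /cmod /= expr0n /= addr0 sqrtr_sqr ger0_norm. Qed.

Lemma cvg_cmodP u z :
  (u @ \oo --> (z : R[i]^o)) <-> (cmod (u n - z) @[n --> \oo] --> (0 : R)).
Proof.
split=> [uz|/cvgrPdist_lt uz].
  apply/cvgrPdist_lt => e e0.
  have e0C : 0 < e%:C%C :> R[i] by rewrite ltcR.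
  move/(@cvgrPdist_lt R[i] R[i]^o nat \oo _ u z)/(_ _ e0C): uz.
  apply: filterS => n /=.
  by rewrite normC_cmod ltcR sub0r normrN ger0_norm ?cmod_ge0// cmod_distC.
apply/(@cvgrPdist_lt R[i] R[i]^o nat \oo _ u z) => -[e1 e2].
(* Positivity in [R[i]] forces the imaginary part of the radius to be zero. *)
rewrite ltcE /= => /andP[/eqP -> e0].
have := uz _ e0; apply: filterS => n /=.
by rewrite normC_cmod ltcR sub0r normrN ger0_norm ?cmod_ge0// cmod_distC.
Qed.

Lemma cvg_cmod u z :
  (u @ \oo --> (z : R[i]^o)) -> cmod (u n) @[n --> \oo] --> cmod z.
Proof.
move/cvg_cmodP/cvgrPdist_lt => uz; apply/cvgrPdist_lt => e e0.
have := uz _ e0; apply: filterS => n /=.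
rewrite sub0r normrN ger0_norm ?cmod_ge0//; apply: le_lt_trans.
rewrite ler_norml; apply/andP; split.
  have := lerB_cmodD (u n) (z - u n).
  by rewrite subrKC [cmod (z - _)]cmod_distC; lra.
by have := lerB_cmodD z (u n - z); rewrite subrKC; lra.
Qed.

Lemma cmod_lim_le u z r :
  (u @ \oo --> (z : R[i]^o)) -> (\forall n \near \oo, cmod (u n) <= r) ->
  cmod z <= r.
Proof.
move=> /cvg_cmod uz ur; rewrite -(cvg_lim _ uz)//.
by apply: limr_le => //; apply/cvg_ex; exists (cmod z).
Qed.

Lemma cmod_lim_ge u z r :
  (u @ \oo --> (z : R[i]^o)) -> (\forall n \near \oo, r <= cmod (u n)) ->
  r <= cmod z.
Proof.
move=> /cvg_cmod uz ur; rewrite -(cvg_lim _ uz)//.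
by apply: limr_ge => //; apply/cvg_ex; exists (cmod z).
Qed.

Lemma Re_sum u N :
  complex.Re (\sum_(0 <= n < N) u n) = \sum_(0 <= n < N) complex.Re (u n).
Proof. by rewrite (big_morph _ (id1 := 0) (op1 := +%R)) => // -[? ?] []. Qed.

Lemma Im_sum u N :
  complex.Im (\sum_(0 <= n < N) u n) = \sum_(0 <= n < N) complex.Im (u n).
Proof. by rewrite (big_morph _ (id1 := 0) (op1 := +%R)) => // -[? ?] []. Qed.

Lemma norm_Re_le_cmod z : `|complex.Re z| <= cmod z.
Proof. by rewrite -lecR; exact: normc_ge_Re. Qed.

Lemma norm_Im_le_cmod z : `|complex.Im z| <= cmod z.
Proof.
case: z => a b /=; rewrite -[ `|b|]sqrtr_sqr ler_wsqrtr//.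
by rewrite lerDr sqr_ge0.
Qed.

Lemma cmod_le_ReIm z : cmod z <= `|complex.Re z| + `|complex.Im z|.
Proof.
case: z => a b /=; rewrite -[leRHS]ger0_norm ?addr_ge0// -sqrtr_sqr.
rewrite ler_wsqrtr// sqrrD !real_normK ?num_real//.
by rewrite lerD2r lerDl mulrn_wge0 ?mulr_ge0.
Qed.

(** Absolute convergence is transferred to the real and imaginary parts, each dominated by the
    modulus. *)
Lemma cvg_series_cmod u :
  cvgn (series (cmod \o u)) ->
  exists z, (\sum_(0 <= n < N) u n) @[N --> \oo] --> (z : R[i]^o).
Proof.
move=> cu.
have cvg_part (p : R[i] -> R) : (forall z, `|p z| <= cmod z) ->
    cvgn (series (p \o u)).
  move=> pu; apply: normed_cvg; apply: series_le_cvg cu => n /=.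
  - exact: normr_ge0.
  - exact: cmod_ge0.
  - exact: pu.
have /cvg_ex[/= x cx] := cvg_part _ norm_Re_le_cmod.
have /cvg_ex[/= y cy] := cvg_part _ norm_Im_le_cmod.
exists (x +i* y)%C; apply/cvg_cmodP.
apply: (@squeeze_cvgr _ _ _ _ (fun=> 0)
  (fun N => `|series (@complex.Re R \o u) N - x| +
            `|series (@complex.Im R \o u) N - y|)).
- near=> N; rewrite cmod_ge0/= /series/= -Re_sum -Im_sum.
  have := cmod_le_ReIm (\sum_(0 <= n < N) u n - (x +i* y)%C).
  by case: (\sum_(0 <= n < N) u n).
- exact: cvg_cst.
- rewrite -[in X in _ --> X](addr0 0); apply: cvgD.
  + rewrite -(@normr0 _ R) -(subrr x); apply: cvg_norm.
    by apply: cvgB cx _; exact: cvg_cst.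
  + rewrite -(@normr0 _ R) -(subrr y); apply: cvg_norm.
    by apply: cvgB cy _; exact: cvg_cst.
Unshelve. all: by end_near. Qed.

End Modulus.

(** * Power series on the disc: growth, existence, uniqueness of coefficients *)

Section PowerSeries.
Context {R : realType}.
Implicit Types (f g : R[i] -> R[i]) (a b c : nat -> R[i]) (z : R[i]).

Lemma sum_succ_geometric_le (r : R) N : 0 <= r < 1 ->
  \sum_(0 <= n < N) n.+1%:R * r ^+ n <= (1 - r) ^- 2.
Proof.
case/andP=> r0 r1; have d0 : 0 < (1 - r) ^+ 2 by rewrite exprn_gt0 ?subr_gt0.
rewrite -[leRHS]mul1r ler_pdivlMr//.
(* The exact value of the partial sum, which induction can prove. *)
suff -> : (\sum_(0 <= n < N) n.+1%:R * r ^+ n) * (1 - r) ^+ 2 =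
    1 - r ^+ N * (1 + N%:R * (1 - r)).
  by rewrite gerBl mulr_ge0 ?exprn_ge0 ?addr_ge0 ?mulr_ge0 ?subr_ge0 ?(ltW r1).
elim: N => [|N IH]; first by rewrite big_geq// expr0 !mul0r addr0 mulr1 subrr.
by rewrite big_nat_recr//= mulrDl IH -natr1 [r ^+ _.+1]exprS; ring.
Qed.

Lemma sum_geometric_half_le (x : R) m N : 0 <= x <= 2^-1 -> (m <= N)%N ->
  \sum_(m <= n < N) x ^+ n <= 2 * x ^+ m.
Proof.
case/andP=> x0 x2 mN.
(* The extra term makes the bound inductive: [x ^+ N + 2 * x ^+ N.+1] is at most [2 * x ^+ N]
   because [x <= 2^-1]. *)
suff : \sum_(m <= n < N) x ^+ n + 2 * x ^+ N <= 2 * x ^+ m.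
  by apply: le_trans; rewrite lerDl mulr_ge0 ?exprn_ge0.
elim: N mN => [|N IH].
  by rewrite leqn0 => /eqP ->; rewrite big_geq ?add0r.
rewrite leq_eqVlt => /predU1P[->|]; first by rewrite big_geq ?add0r.
rewrite ltnS => mN; rewrite big_nat_recr//= -addrA.
apply: le_trans (IH mN); rewrite lerD2l exprS.
have := exprn_ge0 N x0; nra.
Qed.

Section LinearGrowth.
Context a (K : R).
Hypothesis aK : forall n, cmod (a n) <= K * n.+1%:R.

Lemma sum_cmod_power_series_le z N : cmod z < 1 ->
  \sum_(0 <= n < N) cmod (a n * z ^+ n) <= K * (1 - cmod z) ^- 2.
Proof.
move=> z1.
have K0 : 0 <= K by have := aK 0; rewrite mulr1; exact: le_trans (cmod_ge0 _).
apply: (@le_trans _ _ (\sum_(0 <= n < N) K * (n.+1%:R * cmod z ^+ n))).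
  by apply: ler_sum => n _; rewrite cmodM cmodX mulrA ler_wpM2r ?exprn_ge0
    ?cmod_ge0.
by rewrite -mulr_sumr ler_wpM2l// sum_succ_geometric_le ?cmod_ge0.
Qed.

Lemma cmod_power_series_le f z : power_series_on_disc f a -> cmod z < 1 ->
  cmod (f z) <= K * (1 - cmod z) ^- 2.
Proof.
move=> fa z1; apply: cmod_lim_le (fa z z1) _; near=> N.
exact: le_trans (ler_cmod_sum _ _ _) (sum_cmod_power_series_le _ z1).
Unshelve. all: by end_near. Qed.

Lemma power_series_cvg z : cmod z < 1 ->
  exists s, (\sum_(0 <= n < N) a n * z ^+ n) @[N --> \oo] --> (s : R[i]^o).
Proof.
move=> z1; apply: cvg_series_cmod; apply: nondecreasing_is_cvgn.
  by apply/nondecreasing_seqP => N; rewrite /series/= big_nat_recr//= lerDl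
    cmod_ge0.
exists (K * (1 - cmod z) ^- 2) => _ [N _ <-].
exact: sum_cmod_power_series_le.
Qed.

Lemma power_series_exists : exists f,
  (forall z, 1 <= cmod z -> f z = 0) /\ power_series_on_disc f a.
Proof.
have /choice[f fP] : forall z, exists s : R[i],
    (1 <= cmod z -> s = 0) /\
    (cmod z < 1 ->
      (\sum_(0 <= n < N) a n * z ^+ n) @[N --> \oo] --> (s : R[i]^o)).
  move=> z; have [z1|z1] := ltP (cmod z) 1.
    by have [s sP] := power_series_cvg z1; exists s; split.
  by exists 0; split.
by exists f; split=> z; have [] := fP z.
Qed.

End LinearGrowth.

Lemma power_seriesB f g a b : power_series_on_disc f a ->
  power_series_on_disc g b ->
  power_series_on_disc (f \- g) (fun n => a n - b n).
Proof.
move=> fa gb z z1; under eq_fun do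
  [under eq_bigr do rewrite mulrBl; rewrite sumrB].
exact: cvgB (fa z z1) (gb z z1).
Qed.

(** If [c m] were the first nonzero coefficient, then at a small real [t] the term of order [t ^+ m]
    would exceed the tail, which is of order [t ^+ m.+1]. *)
Lemma power_series_zero c : power_series_on_disc (fun=> 0) c ->
  forall n, c n = 0.
Proof.
move=> c0.
have half1 : cmod (2^-1)%:C%C < (1 : R) by rewrite cmod_real; lra.
(* Convergence at 1/2 bounds the partial sums there, hence also their successive differences
   [c n / 2 ^+ n]. *)
have [K K0 cK] : exists2 K : R, 0 < K & forall n, cmod (c n) <= K * 2 ^+ n.
  have := c0 _ half1; set u := fun N => \sum_(0 <= n < N) _ => u0.
  have [M [_ uM]] : bounded_fun (fun n => cmod (u n) : R^o).
    by apply: cvg_seq_bounded; apply/cvg_ex; eexists; exact: (cvg_cmod u0).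
  have {}uM n : cmod (u n) <= `|M| + 1.
    rewrite -[cmod _]ger0_norm ?cmod_ge0//; apply: uM => //.
    by rewrite (le_lt_trans (ler_norm _))// ltrDl.
  exists (2 * (`|M| + 1)) => [|n]; first by rewrite mulr_gt0// ltr_wpDl.
  have -> : c n = (u n.+1 - u n) * (2 ^+ n)%:C%C.
    rewrite /u big_nat_recr//= addrAC subrr add0r -mulrA.
    rewrite (rmorphXn (real_complex R)) -exprMn -(rmorphM (real_complex R))/=.
    by rewrite mulVf// expr1n mulr1.
  rewrite cmodM cmod_real ?exprn_ge0// ler_wpM2r ?exprn_ge0//.
  apply: le_trans (ler_cmodB _ _) _; have := uM n; have := uM n.+1; lra.
elim/ltn_ind => m IH; apply: cmod_eq0; apply/eqP; rewrite eq_le cmod_ge0 andbT.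
rewrite leNgt; apply/negP => cm0.
have bound (t : R) : 0 < t <= 4^-1 ->
    cmod (c m) * t ^+ m <= K * (2 * (2 * t) ^+ m.+1).
  case/andP=> t0 t4; have t1 : cmod t%:C%C < 1 by rewrite cmod_real; lra.
  have tail N : (m < N)%N -> cmod (c m) * t ^+ m - K * (2 * (2 * t) ^+ m.+1) <=
      cmod (\sum_(0 <= n < N) c n * t%:C%C ^+ n).
    move=> mN; rewrite (big_cat_nat (leq0n m.+1) mN)/= big_nat_recr//=.
    rewrite [X in X + _ + _]big_nat big1 ?add0r => [|i /andP[_ im]]; last first.
      by rewrite IH ?mul0r.
    apply: le_trans (lerB_cmodD _ _).
    rewrite cmodM cmodX cmod_real ?(ltW t0)// lerD2l lerN2.
    apply: le_trans (ler_cmod_sum _ _ _) _.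
    apply: (@le_trans _ _ (\sum_(m.+1 <= n < N) K * (2 * t) ^+ n)).
      apply: ler_sum => n _; rewrite cmodM cmodX cmod_real ?(ltW t0)//.
      by rewrite exprMn mulrA ler_wpM2r ?exprn_ge0 ?(ltW t0).
    rewrite -mulr_sumr ler_wpM2l ?(ltW K0)// sum_geometric_half_le//.
    by apply/andP; split; lra.
  rewrite -subr_le0 -(@cmod0 R).
  apply: cmod_lim_ge (c0 _ t1) _; near=> N; apply: tail; near: N.
  exact: nbhs_infty_gt.
(* The first entry keeps [2 * t] below 1/2; the second turns [bound] into
   [cmod (c m) <= cmod (c m) / 2]. *)
pose t := Num.min 4^-1 (cmod (c m) / (K * 2 ^+ m * 8)).
have D0 : 0 < K * 2 ^+ m * 8 by rewrite !mulr_gt0 ?exprn_gt0.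
have t0 : 0 < t by rewrite lt_min invr_gt0 divr_gt0 ?ltr0n.
have := bound t; rewrite t0 ge_min lexx => /(_ isT).
rewrite exprS exprMn [X in _ <= X](_ : _ = K * 2 ^+ m * 4 * t * t ^+ m);
  last ring.
rewrite ler_pM2r ?exprn_gt0// leNgt => /negP; apply.
have : t <= cmod (c m) / (K * 2 ^+ m * 8) by rewrite ge_min lexx orbT.
rewrite ler_pdivlMr//; nra.
Unshelve. all: by end_near. Qed.

Lemma power_series_unique f a b : power_series_on_disc f a ->
  power_series_on_disc f b -> a = b.
Proof.
move=> fa fb; apply/funext => n; apply/eqP; rewrite -subr_eq0; apply/eqP.
apply: (@power_series_zero (fun n => a n - b n)) => z z1.
by have := power_seriesB fa fb z1; rewrite /= subrr.
Qed.

Lemma taylor_coefE f a : power_series_on_disc f a -> taylor_coef f = a.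
Proof.
move=> fa; apply: (power_series_unique (f := f)) => //.
exact: (xgetI (fun=> 0) fa).
Qed.

Lemma taylor_coefP f : analytic_on_disc f ->
  power_series_on_disc f (taylor_coef f).
Proof. by case=> _ [a fa]; rewrite (taylor_coefE fa). Qed.

Lemma taylor_coefB f g : analytic_on_disc f -> analytic_on_disc g ->
  taylor_coef (f \- g) = (fun n => taylor_coef f n - taylor_coef g n).
Proof.
by move=> /taylor_coefP fa /taylor_coefP gb; exact/taylor_coefE/power_seriesB.
Qed.

End PowerSeries.

(** * Squared weighted norms of coefficient sequences *)

Section WeightedNorm.
Context {R : realType}.
Implicit Types (f g : R[i] -> R[i]) (a b c : nat -> R[i]) (nu M e : R).

Definition sqnorm_term nu a n : R := cmod (a n) ^+ 2 * n.+1%:R `^ (2 * nu).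

(** The square of [norm_S], taken on sequences so that estimates can precede the construction of a
    function with these coefficients. *)
Definition sqnorm nu a : \bar R :=
  (\sum_(0 <= n <oo) (sqnorm_term nu a n)%:E)%E.

Lemma norm_SE nu f : norm_S nu f = sqrte (sqnorm nu (taylor_coef f)).
Proof. by []. Qed.

Lemma sqnorm_term_ge0 nu a n : 0 <= sqnorm_term nu a n.
Proof. by rewrite mulr_ge0 ?exprn_ge0 ?cmod_ge0 ?powR_ge0. Qed.

Lemma sqnorm_term_gee0 nu a n : (0 <= (sqnorm_term nu a n)%:E)%E.
Proof. by rewrite lee_fin sqnorm_term_ge0. Qed.
#[local] Hint Resolve sqnorm_term_ge0 sqnorm_term_gee0 : core.

Lemma sqnorm_ge0 nu a : (0 <= sqnorm nu a)%E.
Proof. by apply: nneseries_ge0 => n _ _. Qed.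

Lemma sqnorm_ge_partial nu a N :
  ((\sum_(0 <= n < N) sqnorm_term nu a n)%:E <= sqnorm nu a)%E.
Proof. by rewrite -sumEFin; apply: nneseries_lim_ge => n _ _. Qed.

Lemma sqnorm_le nu a M :
  (forall N, \sum_(0 <= n < N) sqnorm_term nu a n <= M) ->
  (sqnorm nu a <= M%:E)%E.
Proof.
move=> aM; apply: lime_le; first by apply: is_cvg_nneseries => n _ _.
by apply: nearW => N; rewrite sumEFin lee_fin.
Qed.

Lemma sqnorm_ge_term nu a n : ((sqnorm_term nu a n)%:E <= sqnorm nu a)%E.
Proof.
apply: le_trans (sqnorm_ge_partial nu a n.+1); rewrite lee_fin big_nat_recr//=.
by rewrite lerDr sumr_ge0.
Qed.

Lemma norm_S_lt nu f e : 0 < e ->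
  (norm_S nu f < e%:E)%E = (sqnorm nu (taylor_coef f) < (e ^+ 2)%:E)%E.
Proof.
move=> e0; rewrite norm_SE -[e%:E]gee0_abs ?lee_fin ?(ltW e0)// -sqrte_sqr.
by rewrite !ltNge lee_sqrt ?sqnorm_ge0 ?EFin_expe.
Qed.

Lemma norm_S_le nu f M : 0 <= M ->
  (norm_S nu f <= M%:E)%E = (sqnorm nu (taylor_coef f) <= (M ^+ 2)%:E)%E.
Proof.
move=> M0; rewrite norm_SE -[M%:E]gee0_abs ?lee_fin// -sqrte_sqr.
by rewrite lee_sqrt ?sqre_ge0 ?EFin_expe.
Qed.

Lemma norm_S_lty nu f :
  (norm_S nu f < +oo)%E = (sqnorm nu (taylor_coef f) < +oo)%E.
Proof.
have := sqnorm_ge0 nu (taylor_coef f); rewrite norm_SE.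
by case: (sqnorm _ _) => //= r _; rewrite !ltry.
Qed.

(** For [nu >= -1] the weight is at least [n.+1%:R ^- 2], so a single term of the sum gives the
    bound. This linear growth is what the power series estimates take as input. *)
Lemma cmod_coef_le nu a M n : -1 <= nu -> 0 <= M ->
  (sqnorm nu a <= (M ^+ 2)%:E)%E -> cmod (a n) <= M * n.+1%:R.
Proof.
move=> nu1 M0 aM; have := le_trans (sqnorm_ge_term nu a n) aM; rewrite lee_fin.
have n0 : 0 < n.+1%:R ^+ 2 :> R by rewrite exprn_gt0.
have w : n.+1%:R ^- 2 <= n.+1%:R `^ (2 * nu) :> R.
  rewrite -(powR_invn 2) ?ler0n// ler_powR ?ler1n//.
  by rewrite -[1 *- 2]/(- (2%:R : R)); lra.
move=> taM; rewrite -(@ler_pXn2r _ 2) ?nnegrE ?cmod_ge0 ?mulr_ge0// exprMn.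
rewrite -ler_pdivrMr//; apply: le_trans taM.
by rewrite ler_wpM2l ?exprn_ge0 ?cmod_ge0.
Qed.

Lemma sqnorm_mono nu nu' a : nu <= nu' -> (sqnorm nu a <= sqnorm nu' a)%E.
Proof.
move=> nn; apply: lee_nneseries => // n _.
rewrite lee_fin ler_wpM2l ?exprn_ge0 ?cmod_ge0// ler_powR ?ler1n//.
by rewrite ler_pM2l.
Qed.

(** Termwise use of [(x + y)^2 <= 2 * (x^2 + y^2)]; it serves both splices and differences. *)
Lemma sqnorm_lty_dominated nu a b c :
  (forall n, cmod (c n) <= cmod (a n) + cmod (b n)) ->
  (sqnorm nu a < +oo)%E -> (sqnorm nu b < +oo)%E -> (sqnorm nu c < +oo)%E.
Proof.
move=> cab afin bfin.
apply: (@le_lt_trans _ _ (2%:E * (sqnorm nu a + sqnorm nu b))%E); last first.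
  by rewrite lte_mul_pinfty ?lee_fin// lte_add_pinfty.
rewrite /sqnorm -nneseriesD// -nneseriesZl => [|n _]; last exact: adde_ge0.
apply: lee_nneseries => // n _; rewrite -EFinD -EFinM lee_fin -mulrDl mulrA.
rewrite ler_wpM2r ?powR_ge0//.
have := cab n; have := cmod_ge0 (a n); have := cmod_ge0 (b n).
have := cmod_ge0 (c n); have := sqr_ge0 (cmod (a n) - cmod (b n)).
move: (cmod (a n)) (cmod (b n)) (cmod (c n)) => x y w s w0 y0 x0 h.
have : w ^+ 2 <= (x + y) ^+ 2 by rewrite ler_sqr ?nnegrE ?addr_ge0.
by nra.
Qed.

Definition splice j a b : nat -> R[i] :=
  fun n => if (n < j)%N then a n else b n.

Lemma sqnorm_splice_lty nu j a b :
  (sqnorm nu a < +oo)%E -> (sqnorm nu b < +oo)%E ->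
  (sqnorm nu (splice j a b) < +oo)%E.
Proof.
apply: sqnorm_lty_dominated => n; rewrite /splice.
by case: ifP; rewrite ?lerDl ?lerDr cmod_ge0.
Qed.

(** The head of the sum is at most [sqnorm] of [a - c], and the rest is a tail of a convergent
    series, hence smaller than the slack below [M]. The centre [c] is arbitrary because a subbasic
    ball containing a point need not be centred there. *)
Lemma sqnorm_splice_near nu a b c M :
  (sqnorm nu (fun n => a n - c n)%R < M%:E)%E ->
  (sqnorm nu (fun n => b n - c n)%R < +oo)%E ->
  \forall j \near \oo, (sqnorm nu (fun n => splice j a b n - c n)%R < M%:E)%E.
Proof.
set u := fun n => a n - c n; set v := fun n => b n - c n => uM vfin.
have ufin : sqnorm nu u \is a fin_num.
  by rewrite ge0_fin_numE ?sqnorm_ge0// (lt_trans uM) ?ltry.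
have /= tail := nneseries_tail_cvg vfin (fun n _ => sqnorm_term_gee0 nu v n).
have d0 : 0 < M - fine (sqnorm nu u).
  by rewrite subr_gt0 -lte_fin fineK.
have /fine_cvgP[tfin /cvgr_lt/(_ _ d0) tlt] := tail.
near=> j.
have tfinj : (\sum_(j <= k <oo) (sqnorm_term nu v k)%:E)%E \is a fin_num.
  by near: j.
rewrite /sqnorm (nneseries_split 0 j) => [|n _]; last exact: sqnorm_term_gee0.
rewrite add0n [X in (X + _)%E](_ : _ =
    (\sum_(0 <= n < j) sqnorm_term nu u n)%:E)%E; last first.
  rewrite sumEFin; congr (_%:E); apply: eq_big_nat => n /andP[_ nj].
  by rewrite /sqnorm_term /splice nj.
rewrite [X in (_ + X)%E](_ : _ =
    (\sum_(j <= n <oo) (sqnorm_term nu v n)%:E)%E); last first.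
  rewrite eseries_cond [RHS]eseries_cond; apply: eq_eseriesr => n /= jn.
  by rewrite /sqnorm_term /splice ltnNge jn.
apply: (@le_lt_trans _ _ (sqnorm nu u + (fine
    (\sum_(j <= n <oo) (sqnorm_term nu v n)%:E)%E)%:E)%E).
  by rewrite leeD ?sqnorm_ge_partial ?fineK.
rewrite -[sqnorm nu u]fineK// -EFinD lte_fin -ltrBrDl.
near: j; exact: tlt.
Unshelve. all: by end_near. Qed.

End WeightedNorm.

(** * The lacunary series: its norms and its size on the chosen circles *)

Section Lacunary.
Context {R : realType}.
Implicit Types (z : R[i]) (nu r : R).

Definition gap (k : nat) : nat := (64 ^ (k ^ 2))%N.

(** The sum has at most one term, [gap] being injective, and [k <= gap k] justifies its range; this
    avoids an inverse of [gap]. *)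
Definition lacunary (n : nat) : R[i] :=
  (\sum_(0 <= k < n.+1 | gap k == n) 4 ^+ k)%:C%C.

Lemma gap_gt0 k : (0 < gap k)%N.
Proof. by rewrite expn_gt0. Qed.

Lemma gap_mono : {mono gap : j k / (j <= k)%N}.
Proof. by move=> j k; rewrite leq_exp2l// leq_exp2r. Qed.

Lemma gap_inj : injective gap.
Proof. exact: incn_inj gap_mono. Qed.

Lemma leq_gap k : (k <= gap k)%N.
Proof.
rewrite (leq_trans (ltnW (ltn_expl k (isT : 1 < 64)%N)))// leq_exp2l//.
by rewrite -[leqLHS]muln1 expnS expn1 leq_mul2l; case: k.
Qed.

(** For [k < j] one has [k^2 + j <= j^2]; this is what the squares in the exponents provide. *)
Lemma gap_ratio k j : (k < j)%N -> (gap k * 64 ^ j <= gap j)%N.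
Proof.
by move=> kj; rewrite -expnD leq_exp2l//; nia.
Qed.

Lemma lacunary_gap k : lacunary (gap k) = (4 ^+ k)%:C%C.
Proof.
rewrite /lacunary; congr (_%:C)%C.
under eq_bigl do rewrite (inj_eq gap_inj).
by rewrite big_mkord (big_pred1 (Ordinal (leq_gap k : k < (gap k).+1)%N)).
Qed.

Lemma lacunary_out n : (forall k, gap k != n) -> lacunary n = 0.
Proof.
by move=> out; rewrite /lacunary big1// => k; rewrite (negbTE (out k)).
Qed.

Lemma sum_gap (V : zmodType) (F : nat -> V) K :
  (forall n, (forall k, gap k != n) -> F n = 0) ->
  \sum_(0 <= n < gap K) F n = \sum_(0 <= k < K) F (gap k).
Proof.
move=> F0; elim: K => [|K IH].
  rewrite [gap 0]/= big_nat1 big_geq// F0// => k.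
  by rewrite -lt0n gap_gt0.
have ltK : (gap K < gap K.+1)%N by rewrite (leqW_mono gap_mono).
rewrite (big_cat_nat (leq0n (gap K)) (ltnW ltK))/= IH big_nat_recr//=.
(* From [gap K] up to [gap K.+1] excluded, only the first index is a gap. *)
congr (_ + _); rewrite big_ltn// big_nat big1 ?addr0// => n /andP[Kn nK].
apply: F0 => k; apply/eqP => kn; move: Kn nK.
by rewrite -kn !(leqW_mono gap_mono) ltnS => ? ?; lia.
Qed.

Lemma bernoulli_le (x : R) n : -1 <= x -> 1 + n%:R * x <= (1 + x) ^+ n.
Proof.
move=> x1; elim: n => [|n IH]; first by rewrite mul0r addr0.
rewrite exprS -natr1; have : 0 <= n%:R :> R by [].
move: (n%:R) IH => m IH m0.
apply: (@le_trans _ _ ((1 + x) * (1 + m * x))); first by nra.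
by rewrite ler_wpM2l//; lra.
Qed.

Lemma sum_quarter_le K : \sum_(0 <= k < K) (4^-1 : R) ^+ k <= 2.
Proof.
have := @sum_geometric_half_le R 4^-1 0 K; rewrite expr0 mulr1; apply => //.
by apply/andP; split; lra.
Qed.

(** The term at [gap k] is [16^k * 64^(2 nu k^2)]. Once [2 nu k <= -1] the second factor is at most
    [64^(-k)], which leaves [4^(-k)]; the finitely many earlier [k] are absorbed by the constant
    [64 ^+ k0]. *)
Lemma sqnorm_lacunary nu : nu < 0 -> (sqnorm nu lacunary < +oo)%E.
Proof.
move=> nu0; pose k0 := Num.bound (- (2 * nu))^-1.
have k0P k : (k0 <= k)%N -> k%:R * (2 * nu) <= -1.
  move=> k0k; have p0 : 0 < - (2 * nu) by lra.
  have : (- (2 * nu))^-1 <= k%:R.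
    apply/ltW/(lt_le_trans (archi_boundP _)); rewrite ?invr_ge0 ?(ltW p0)//.
    by rewrite ler_nat.
  by rewrite -[X in X <= _]mul1r ler_pdivrMr//; lra.
suff term k : sqnorm_term nu lacunary (gap k) <= 64 ^+ k0 * 4^-1 ^+ k.
  apply: (@le_lt_trans _ _ (64 ^+ k0 * 2)%:E); last exact: ltry.
  apply: sqnorm_le => N.
  apply: (@le_trans _ _ (\sum_(0 <= n < gap N) sqnorm_term nu lacunary n)).
    rewrite (big_cat_nat (leq0n N) (leq_gap N))/= lerDl sumr_ge0// => n _.
    exact: sqnorm_term_ge0.
  rewrite sum_gap => [|n out]; last first.
    by rewrite /sqnorm_term lacunary_out// cmod0 expr0n mul0r.
  apply: (@le_trans _ _ (\sum_(0 <= k < N) 64 ^+ k0 * 4^-1 ^+ k)).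
    by apply: ler_sum => k _; exact: term.
  by rewrite -mulr_sumr ler_wpM2l ?exprn_ge0// sum_quarter_le.
rewrite /sqnorm_term lacunary_gap cmod_real ?exprn_ge0//.
apply: (@le_trans _ _ ((4 ^+ k) ^+ 2 * 64 `^ (k%:R * (k%:R * (2 * nu))))).
  rewrite ler_wpM2l ?exprn_ge0// mulrA -natrM mulnn.
  rewrite [64 `^ _]powRrM powR_mulrn//.
  have [s s0 ->] : exists2 s, 0 <= s & 2 * nu = - s.
    by exists (- (2 * nu)); rewrite ?opprK//; lra.
  rewrite -natrX -/(gap k) !powRN lef_pV2 ?posrE ?powR_gt0 ?ltr0n ?gap_gt0//.
  by rewrite ge0_ler_powR ?nnegrE ?ler_nat.
have -> : (4 ^+ k : R) ^+ 2 = 64 ^+ k * 4^-1 ^+ k.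
  by rewrite -exprM mulnC exprM -exprMn; congr (_ ^+ _); lra.
rewrite mulrAC ler_wpM2r ?exprn_ge0//.
have [k0k|kk0] := leqP k0 k.
  apply: (@le_trans _ _ (64 ^+ k * 64 `^ (- k%:R))).
    rewrite ler_wpM2l ?exprn_ge0// ler_powR ?ler1n//.
    by have := k0P _ k0k; have : 0 <= k%:R :> R by []; nra.
  rewrite powRN powR_mulrn// divff ?expf_neq0//.
  by rewrite exprn_ege1 ?ler1n.
apply: (@le_trans _ _ (64 ^+ k * 64 `^ 0)).
  rewrite ler_wpM2l ?exprn_ge0// ler_powR ?ler1n//.
  by have : 0 <= k%:R :> R by []; move: (k%:R) => m; nra.
by rewrite powRr0 mulr1 ler_weXn2l ?ler1n// ltnW.
Qed.

Definition gap_radius k : R := 1 - ((gap k)%:R * 2)^-1.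

Lemma gap_radius_itv k : 0 <= gap_radius k < 1.
Proof.
have g1 : 1 <= (gap k)%:R :> R by rewrite ler1n gap_gt0.
have g0 : 0 < (gap k)%:R * 2 :> R by lra.
rewrite /gap_radius ltrBlDr ltrDl invr_gt0 g0 andbT subr_ge0 invf_le1//; lra.
Qed.

Lemma gap_radius_head k : 2^-1 <= gap_radius k ^+ gap k.
Proof.
have g1 : 1 <= (gap k)%:R :> R by rewrite ler1n gap_gt0.
apply: le_trans (bernoulli_le _ _); rewrite -/(gap_radius k).
  by rewrite mulrN invfM mulrA divff; lra.
by have := gap_radius_itv k; rewrite /gap_radius; lra.
Qed.

(** With [x = 1 / (2 * gap k)], the product [(1 - x)^n * (1 + x)^n] is at most 1, and Bernoulli
    gives [(1 + x)^n >= n * x]; for [n = gap j] the latter is at least [64^j / 2]. *)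
Lemma gap_radius_tail k j : (k < j)%N ->
  gap_radius k ^+ gap j <= 2 * (64 ^+ j)^-1.
Proof.
move=> kj; have g1 : 1 <= (gap k)%:R :> R by rewrite ler1n gap_gt0.
pose x : R := ((gap k)%:R * 2)^-1.
have x0 : 0 < x by rewrite invr_gt0; lra.
have x1 : x <= 1 by have := gap_radius_itv k; rewrite /gap_radius -/x; lra.
have gx : 64 ^+ j / 2 <= (gap j)%:R * x.
  rewrite /x ler_pdivlMr; last lra.
  have := gap_ratio kj; rewrite -(ler_nat R) natrM natrX; lra.
have P0 : 0 < (64 ^+ j : R) by rewrite exprn_gt0.
have r0 : 0 <= gap_radius k ^+ gap j.
  by rewrite exprn_ge0//; case/andP: (gap_radius_itv k).
have : gap_radius k ^+ gap j * (64 ^+ j / 2) <= 1.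
  apply: (@le_trans _ _ (gap_radius k ^+ gap j * (1 + x) ^+ gap j)).
    rewrite ler_wpM2l//; apply: le_trans (bernoulli_le _ _); lra.
  by rewrite -exprMn exprn_ile1// /gap_radius -/x; nra.
by rewrite -ler_pdivlMr ?divr_gt0// invfM invrK mul1r mulrC.
Qed.

(** The [k]-th term has modulus at least [4^k / 2], the earlier ones add up to at most [4^k / 3],
    and the later ones, bounded by [2 * 16^(-j)], to at most 1. *)
Lemma lacunary_lower k K z : cmod z = gap_radius k -> (k < K)%N ->
  4 ^+ k / 6 - 1 <= cmod (\sum_(0 <= n < gap K) lacunary n * z ^+ n).
Proof.
move=> zk kK; rewrite sum_gap => [|n out]; last by rewrite lacunary_out ?mul0r.
have cterm j : cmod (lacunary (gap j) * z ^+ gap j) =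
    4 ^+ j * gap_radius k ^+ gap j.
  by rewrite cmodM cmodX zk lacunary_gap cmod_real ?exprn_ge0.
have /andP[r0 r1] := gap_radius_itv k.
have head :
    \sum_(0 <= j < k) cmod (lacunary (gap j) * z ^+ gap j) <= 4 ^+ k / 3.
  apply: (@le_trans _ _ (\sum_(0 <= j < k) 4 ^+ j)).
    apply: ler_sum => j _; rewrite cterm -[leRHS]mulr1 ler_wpM2l ?exprn_ge0//.
    by rewrite exprn_ile1// ltW.
  elim: (k) => [|m IH]; first by rewrite big_geq// divr_ge0.
  by rewrite big_nat_recr//= exprS; lra.
have tail : \sum_(k.+1 <= j < K) cmod (lacunary (gap j) * z ^+ gap j) <= 1.
  apply: (@le_trans _ _ (\sum_(k.+1 <= j < K) 2 * (16^-1) ^+ j)).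
    rewrite big_nat [leRHS]big_nat; apply: ler_sum => j /andP[kj _].
    have -> : 2 * 16^-1 ^+ j = 4 ^+ j * (2 * (64 ^+ j)^-1) :> R.
      rewrite -!exprVn mulrCA -exprMn; congr (_ * _ ^+ _); lra.
    by rewrite cterm ler_wpM2l ?exprn_ge0// gap_radius_tail.
  have x16 : 0 <= (16^-1 : R) <= 2^-1 by apply/andP; split; lra.
  rewrite -mulr_sumr; have := sum_geometric_half_le x16 kK.
  have : 16^-1 ^+ k.+1 <= 16^-1 :> R.
    by rewrite exprS -[leRHS]mulr1 ler_wpM2l// exprn_ile1//; lra.
  lra.
have mid : 4 ^+ k / 2 <= cmod (lacunary (gap k) * z ^+ gap k).
  by rewrite cterm ler_wpM2l ?exprn_ge0// gap_radius_head.
rewrite (big_cat_nat (leq0n k) (ltnW kK))/= (big_ltn kK) addrCA.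
apply: le_trans (lerB_cmodD _ _).
have := ler_cmodD (\sum_(0 <= j < k) lacunary (gap j) * z ^+ gap j)
  (\sum_(k.+1 <= j < K) lacunary (gap j) * z ^+ gap j).
have := ler_cmod_sum (index_iota 0 k) xpredT
  (fun j => lacunary (gap j) * z ^+ gap j).
have := ler_cmod_sum (index_iota k.+1 K) xpredT
  (fun j => lacunary (gap j) * z ^+ gap j).
lra.
Qed.

End Lacunary.

(** * Series that agree with the lacunary one from some index on *)

Section LacunaryTail.
Context {R : realType}.
Implicit Types (f g : R[i] -> R[i]) (a : nat -> R[i]).

Lemma cvg_gap : gap @ \oo --> \oo.
Proof.
move=> A [N _ NA]; exists N => // k /= Nk; apply: NA => /=.
exact: leq_trans Nk (leq_gap k).
Qed.

(** The difference from the lacunary series is a polynomial, bounded on the disc by the sum [P] of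
    the moduli of its coefficients, whatever [k] is. *)
Lemma lacunary_tail_lower f a j : power_series_on_disc f a ->
  (forall n, (j <= n)%N -> a n = lacunary n) ->
  exists P : R, forall k z, cmod z = gap_radius k ->
    4 ^+ k / 6 - 1 - P <= cmod (f z).
Proof.
move=> fa aj; exists (\sum_(0 <= n < j) cmod (a n - lacunary n)) => k z zk.
have /andP[r0 r1] := @gap_radius_itv R k.
have z1 : cmod z < 1 by rewrite zk.
pose S N : R[i] := \sum_(0 <= n < N) a n * z ^+ n.
(* Only the partial sums cut at a gap are kept, since [lacunary_lower] is about these. *)
have sub : S (gap K) @[K --> \oo] --> (f z : R[i]^o).
  exact: (cvg_comp gap S cvg_gap (fa z z1)).
apply: cmod_lim_ge sub _; near=> K.
have kK : (k < K)%N by near: K; exact: nbhs_infty_gt.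
have jK : (j <= gap K)%N.
  by apply: leq_trans (leq_gap K); near: K; exact: nbhs_infty_ge.
rewrite (_ : S (gap K) =
  \sum_(0 <= n < gap K) lacunary n * z ^+ n +
  \sum_(0 <= n < j) (a n - lacunary n) * z ^+ n).
  apply: le_trans (lerB_cmodD _ _); apply: lerB; first exact: lacunary_lower.
  apply: le_trans (ler_cmod_sum _ _ _) _; apply: ler_sum => n _.
  rewrite cmodM cmodX zk -[leRHS]mulr1 ler_wpM2l ?cmod_ge0//.
  by rewrite exprn_ile1// ltW.
have -> : \sum_(0 <= n < j) (a n - lacunary n) * z ^+ n =
    \sum_(0 <= n < gap K) (a n - lacunary n) * z ^+ n.
  rewrite (big_cat_nat (leq0n j) jK)/= [X in _ = _ + X]big_nat.
  rewrite [X in _ = _ + X]big1 ?addr0//.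
  by move=> n /andP[jn _]; rewrite aj// subrr mul0r.
by rewrite -big_split/=; apply: eq_bigr => n _; rewrite mulrBl subrKC.
Unshelve. all: by end_near. Qed.

End LacunaryTail.

(** * The space [hatS0_type]: coefficients, topology, dense elements *)

Section HatS0.
Context {R : realType} (nu : nat -> R).
Hypothesis nu_lt0 : forall k, nu k < 0.
Hypothesis nu_to0 : nu @ \oo --> (0 : R).
Implicit Types (g h : hatS0_type nu) (e c r : R).

Definition coef g := taylor_coef (hatS0_fun g).

Lemma hatS0P f : hatS0 f <-> analytic_on_disc f /\
  forall mu : R, mu < 0 -> (sqnorm mu (taylor_coef f) < +oo)%E.
Proof.
split=> [fS|[fan fS] mu mu0]; last by split=> //; rewrite norm_S_lty; exact: fS.
split=> [|mu mu0]; first by have [] := fS (-1) (ltrN10 R).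
by have [_] := fS _ mu0; rewrite norm_S_lty.
Qed.

Lemma hatS0_fun_in g : hatS0 (hatS0_fun g).
Proof. exact: (set_valP (g : set_type hatS0)). Qed.

Lemma hatS0_analytic g : analytic_on_disc (hatS0_fun g).
Proof. by have /hatS0P[] := hatS0_fun_in g. Qed.

Lemma coef_power_series g : power_series_on_disc (hatS0_fun g) (coef g).
Proof. exact/taylor_coefP/hatS0_analytic. Qed.

Lemma sqnorm_coef_lty g (mu : R) : mu < 0 -> (sqnorm mu (coef g) < +oo)%E.
Proof. by have /hatS0P[_] := hatS0_fun_in g; exact. Qed.

Lemma taylor_coef_sub g h : taylor_coef (hatS0_fun h \- hatS0_fun g) =
  (fun n => coef h n - coef g n).
Proof. exact: taylor_coefB (hatS0_analytic _) (hatS0_analytic _). Qed.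

Lemma hatS0_ballE k g h e : 0 < e -> hatS0_ball k g e h =
  (sqnorm (nu k) (fun n => coef h n - coef g n)%R < (e ^+ 2)%:E)%E :> Prop.
Proof. by move=> e0; rewrite /hatS0_ball/= norm_S_lt// taylor_coef_sub. Qed.

Lemma hatS0_exists a : (forall mu : R, mu < 0 -> (sqnorm mu a < +oo)%E) ->
  exists g, coef g = a.
Proof.
move=> afin; have := afin _ (ltrN10 R); have := sqnorm_ge0 (-1) a.
case aE : (sqnorm (-1) a) => [s| |]//; rewrite lee_fin => s0 _.
(* Since [s <= (s + 1) ^+ 2], the constant [s + 1] does the work of the square root of [s]. *)
have aK n : cmod (a n) <= (s + 1) * n.+1%:R.
  apply: (@cmod_coef_le _ (-1)) => //; first by rewrite addr_ge0.
  by rewrite aE lee_fin; nra.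
have [f [f0 fa]] := power_series_exists aK.
have fS : hatS0 f.
  by apply/hatS0P; rewrite (taylor_coefE fa); split=> //; split=> //; exists a.
by exists (SigSub (mem_set fS)); exact: taylor_coefE.
Qed.

Lemma hatS0_ball_center k g e : 0 < e -> hatS0_ball k g e g.
Proof.
move=> e0; rewrite hatS0_ballE//; apply: (@le_lt_trans _ _ 0%:E); last first.
  by rewrite lte_fin exprn_gt0.
apply: sqnorm_le => N; rewrite big1// => n _.
by rewrite /sqnorm_term subrr cmod0 expr0n mul0r.
Qed.

Lemma open_hatS0_ball k g e : 0 < e -> open (hatS0_ball k g e).
Proof.
move=> e0; exists [set hatS0_ball k g e]; last by rewrite bigcup_set1.
by move=> _ ->; apply: (@finI_from1 _ _ _ id); exists k, g, e.
Qed.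

Lemma hatS0_open (U : set (hatS0_type nu)) :
  (forall g, U g -> exists k e, 0 < e /\ hatS0_ball k g e `<=` U) -> open U.
Proof.
move=> UP; rewrite openE => g /UP[k [e [e0 eU]]].
apply: filterS eU _; apply: open_nbhs_nbhs; split.
  exact: open_hatS0_ball.
exact: hatS0_ball_center.
Qed.

(** Around [g], an open set contains a finite intersection of subbasic balls containing [g], and
    finitely many eventual conditions hold together eventually. Convergence can thus be tested on
    subbasic balls alone. *)
Lemma hatS0_open_near (U : set (hatS0_type nu)) g (u : nat -> hatS0_type nu) :
  open U -> U g ->
  (forall k h e, 0 < e -> hatS0_ball k h e g ->
    \forall j \near \oo, hatS0_ball k h e (u j)) ->
  \forall j \near \oo, U (u j).
Proof.
move=> [D Dfin <-] [V DV Vg] uP.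
have [E EP EV] := Dfin _ DV.
have Eg W : W \in E -> \forall j \near \oo, W (u j).
  move=> WE; have /set_mem[k [h [e [e0 WB]]]] := EP _ WE.
  rewrite WB; apply: uP => //; rewrite -WB.
  by move: Vg; rewrite -EV; exact.
have Enear : \forall j \near \oo,
    (\bigcap_(W in [set` E]) [set j | W (u j)]) j by exact: filter_bigI Eg.
apply: filterS Enear => j jE.
have Vj : (V : set (hatS0_type nu)) (u j) by rewrite -EV => W WE; exact: jE.
by exists V.
Qed.

Lemma coef_dist_le k g h e n : -1 <= nu k -> 0 < e -> hatS0_ball k g e h ->
  cmod (coef h n - coef g n) <= e * n.+1%:R.
Proof.
move=> nk e0; rewrite hatS0_ballE// => /ltW.
exact: (cmod_coef_le (a := fun n => coef h n - coef g n) n nk (ltW e0)).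
Qed.

Lemma value_dist_le k g h e z : -1 <= nu k -> 0 < e -> hatS0_ball k g e h ->
  cmod z < 1 -> cmod (hatS0_fun h z - hatS0_fun g z) <= e * (1 - cmod z) ^- 2.
Proof.
move=> nk e0 hg;
apply: (@cmod_power_series_le _ (fun n => coef h n - coef g n) e _
  (hatS0_fun h \- hatS0_fun g)).
  by move=> n; exact: coef_dist_le nk e0 hg.
apply: power_seriesB; exact: coef_power_series.
Qed.

(** The limit of [nu] enters here: one of the defining norms is strong enough to control
    coefficients and point values. *)
Lemma nu_ge_m1 : exists k, -1 <= nu k.
Proof.
have : \forall k \near \oo, -1 < nu k.
  by apply: cvgr_gt nu_to0 _ _; rewrite ltrN10.
by case=> N _ /(_ N (leqnn N)) /ltW; exists N.
Qed.

Lemma splice_exists g j : exists h, coef h = splice j (coef g) lacunary.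
Proof.
apply: hatS0_exists => mu mu0; apply: sqnorm_splice_lty.
  exact: sqnorm_coef_lty.
exact: sqnorm_lacunary.
Qed.

Lemma lacunary_tail_dense (U : set (hatS0_type nu)) : open U -> U !=set0 ->
  exists2 h, U h & exists j, forall n, (j <= n)%N -> coef h n = lacunary n.
Proof.
move=> Uo [g Ug]; have [u uP] := choice (splice_exists g).
have [] : \forall j \near \oo, U (u j).
  apply: (hatS0_open_near Uo Ug) => k h e e0; rewrite hatS0_ballE// => gh.
  have lfin : (sqnorm (nu k) (fun n => lacunary n - coef h n)%R < +oo)%E.
    apply: sqnorm_lty_dominated (sqnorm_lacunary (nu_lt0 k))
      (sqnorm_coef_lty h (nu_lt0 k)) => n.
    exact: ler_cmodB.
  have [N _ NP] := sqnorm_splice_near gh lfin.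
  exists N => [|j Nj]; first exact: I.
  by rewrite (hatS0_ballE k h (u j) e0) uP; exact: NP.
move=> N _ /(_ N (leqnn N)) UN; exists (u N) => //; exists N => n Nn.
by rewrite uP /splice ltnNge Nn.
Qed.

(** The constant [c] stands for the minimum of the modulus on the circle of radius [r]; the slack
    [c - n] makes the condition open. *)
Definition large_on_circle (n : nat) : set (hatS0_type nu) :=
  [set g | exists r c, [/\ 1 - n.+1%:R^-1 < r < 1, n%:R < c &
    forall w, circle w -> c <= cmod (hatS0_fun g (r%:C%C * w))]].

Lemma large_radius_ge0 n r : 1 - n.+1%:R^-1 < r -> 0 <= r.
Proof.
move=> nr; apply: le_trans (ltW nr).
by rewrite subr_ge0 invf_le1 ?ler1n.
Qed.

Lemma open_large_on_circle n : open (large_on_circle n).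
Proof.
apply: hatS0_open => g [r [c [/andP[nr r1] nc gc]]].
have r0 := large_radius_ge0 nr.
have [k nk] := nu_ge_m1.
have d0 : 0 < (1 - r) ^+ 2 by rewrite exprn_gt0 ?subr_gt0.
(* The factor [(1 - r) ^+ 2] cancels the one in [value_dist_le], so values on the circle move by at
   most half the slack. *)
have e0 : 0 < (c - n%:R) / 2 * (1 - r) ^+ 2.
  by rewrite mulr_gt0 ?divr_gt0 ?subr_gt0.
exists k, ((c - n%:R) / 2 * (1 - r) ^+ 2); split=> // h hg.
exists r, (c - (c - n%:R) / 2); split; [by apply/andP | lra |] => w cw.
have rw : cmod (r%:C%C * w) = r by rewrite cmodM cw mulr1 cmod_real.
have := value_dist_le nk e0 hg (z := r%:C%C * w).
rewrite rw => /(_ r1); rewrite mulfK ?gt_eqF// => hgw.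
have := lerB_cmodD (hatS0_fun g (r%:C%C * w))
  (hatS0_fun h (r%:C%C * w) - hatS0_fun g (r%:C%C * w)).
by rewrite subrKC; have := gc _ cw; lra.
Qed.

Lemma lacunary_tail_large g j n :
  (forall m, (j <= m)%N -> coef g m = lacunary m) -> large_on_circle n g.
Proof.
move=> gj; have [P gP] := lacunary_tail_lower (@coef_power_series g) gj.
(* The first summand brings the radius close enough to 1; the second gives
   [4^k > k > 6 * (n + 1 + P)], so that the lower bound exceeds [n]. *)
pose k := (n.+1 + Num.bound (`|6 * (n%:R + 1 + P)|%R : R))%N.
have /andP[_ r1] := @gap_radius_itv R k.
have r0 : 1 - n.+1%:R^-1 < gap_radius k :> R.
  rewrite /gap_radius ltrD2l ltrN2 ltf_pV2 ?posrE ?ltr0n// -?natrM ?ltr0n//.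
    rewrite ltr_nat; have := leq_gap k; rewrite /k; lia.
  by have := gap_gt0 k; lia.
exists (gap_radius k), (4 ^+ k / 6 - 1 - P); split; first by apply/andP.
  have kP : 6 * (n%:R + 1 + P) < k%:R.
    apply: le_lt_trans (ler_norm _) _.
    apply: lt_le_trans (archi_boundP (normr_ge0 _)) _.
    by rewrite ler_nat leq_addl.
  have : k%:R < 4 ^+ k :> R by rewrite -natrX ltr_nat ltn_expl.
  lra.
move=> w cw; apply: gP; rewrite cmodM cw mulr1 cmod_real//.
by case/andP: (@gap_radius_itv R k).
Qed.

Lemma limsup_large_on_circle g w : (\bigcap_n large_on_circle n) g ->
  circle w ->
  limf_esup (fun r : R => (cmod (hatS0_fun g (r%:C%C * w)))%:E) 1^'- = +oo%E.
Proof.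
move=> gl cw; rewrite limf_esupE; apply/eqyP => A A0.
apply: le_ereal_inf_tmp => _ [V V1 <-].
have [d /= d0 dV] := V1.
(* The first summand makes the value exceed [A], the second puts the radius within [d] of 1. *)
pose n := (Num.bound A + Num.bound d^-1)%N.
have [r [c [/andP[nr r1] nc gc]]] := gl n I.
apply: (@le_trans _ _ (cmod (hatS0_fun g (r%:C%C * w)))%:E).
  rewrite lee_fin; apply: le_trans (gc _ cw); apply: ltW; apply: le_lt_trans nc.
  apply/ltW/(lt_le_trans (archi_boundP (ltW A0))).
  by rewrite ler_nat leq_addr.
apply: ereal_sup_ubound; exists r => //; apply: dV => //=.
rewrite ger0_norm ?subr_ge0 ?(ltW r1)// ltrBlDr -ltrBlDl; apply: le_lt_trans nr.
rewrite lerD2l lerN2 -[leRHS]invrK lef_pV2 ?posrE ?invr_gt0//.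
apply/ltW/(lt_le_trans (archi_boundP _)); first by rewrite invr_ge0 ltW.
by rewrite ler_nat /n; lia.
Qed.

Lemma circle_expi (t : R) : circle (expi t).
Proof. by rewrite /circle/= /cmod/= cos2Dsin2 sqrtr1. Qed.

Lemma circle_measure_full (F : set R[i]) :
  (forall w, circle w -> F w) -> circle_measure F = 1%E.
Proof.
move=> FT; rewrite /circle_measure.
rewrite (_ : [set t : R | _] = [set` `[0, 2 * pi[]); last first.
  apply/seteqP; split=> t /=; rewrite in_itv/=; first by case.
  by move=> t2pi; split=> //; exact/FT/circle_expi.
have pi2 : 0 < 2 * pi :> R by rewrite mulr_gt0 ?pi_gt0.
rewrite lebesgue_measure_itv/= lte_fin pi2 -EFinB -EFinM subr0.
by rewrite mulVf ?gt_eqF.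
Qed.

(** * The Hardy space as a countable union of nowhere dense balls *)

Definition S0_ball (i : nat) : set (hatS0_type nu) :=
  [set g | (norm_S 0 (hatS0_fun g) <= i%:R%:E)%E].

Lemma coef_S0_ball i g n : S0_ball i g -> cmod (coef g n) <= i%:R.
Proof.
rewrite /S0_ball/= norm_S_le// => gi.
have := le_trans (sqnorm_ge_term 0 (coef g) n) gi.
by rewrite lee_fin /sqnorm_term mulr0 powRr0 mulr1 ler_pXn2r ?nnegrE ?cmod_ge0.
Qed.

(** An interior point of the closure could be chosen with lacunary tail; elements of the ball close
    to it would then have a coefficient larger than [i]. *)
Lemma nowhere_dense_S0_ball i : nowhere_dense (S0_ball i).
Proof.
rewrite /nowhere_dense -subset0 => g ig.
have [h hcl [j hj]] : exists2 h, (closure (S0_ball i))° h &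
    exists j, forall n, (j <= n)%N -> coef h n = lacunary n.
  by apply: lacunary_tail_dense; [exact: open_interior | exists g].
have [k nk] := nu_ge_m1.
pose m := (i.+1 + j)%N.
(* This radius cancels the factor [n.+1] of [coef_dist_le] at [n = gap m]: that coefficient stays
   within 1 of [4 ^+ m], which exceeds [i + 1]. *)
have e0 : 0 < ((gap m).+1%:R)^-1 :> R by rewrite invr_gt0.
have [] := interior_subset hcl (hatS0_ball k h (gap m).+1%:R^-1).
  apply: open_nbhs_nbhs; split; first exact: open_hatS0_ball.
  exact: hatS0_ball_center.
move=> f [fi /(coef_dist_le (gap m) nk e0)].
rewrite mulVf// hj; last by have := leq_gap m; rewrite /m; lia.
rewrite lacunary_gap => fh; have fm := coef_S0_ball (gap m) fi.
have := lerB_cmodD (4 ^+ m)%:C%C (coef f (gap m) - (4 ^+ m)%:C%C).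
rewrite subrKC cmod_real ?exprn_ge0//.
have : i.+1%:R < 4 ^+ m :> R.
  rewrite -natrX ltr_nat; apply: leq_ltn_trans (ltn_expl m _) => //.
  by rewrite /m leq_addr.
rewrite -natr1; lra.
Qed.

Lemma space_S0_bigcup :
  [set g : hatS0_type nu | space_S 0 (hatS0_fun g)] = \bigcup_i S0_ball i.
Proof.
apply/seteqP; split=> [g [_ gfin]|g [i _ gi]]; last first.
  split; first exact: hatS0_analytic.
  exact: le_lt_trans gi (ltry _).
have : (0 <= norm_S 0 (hatS0_fun g))%E by rewrite norm_SE sqrte_ge0.
rewrite /bigcup/S0_ball/=; move: gfin.
case: (norm_S _ _) => [s| |]// _; rewrite lee_fin => s0.
exists (Num.bound s) => //.
by rewrite lee_fin; apply/ltW/archi_boundP.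
Qed.

Lemma space_S0_sub : space_S (0 : R) `<=` hatS0.
Proof.
move=> f [fan]; rewrite norm_S_lty => ffin; apply/hatS0P; split=> // mu mu0.
exact: le_lt_trans (sqnorm_mono _ (ltW mu0)) ffin.
Qed.

End HatS0.

Theorem corollary3p9 (R : realType) (nu : nat -> R)
    (nu_lt0 : forall k, nu k < 0) (nu_to0 : nu @ \oo --> (0 : R)) :
  residual [set g : hatS0_type nu |
    circle_measure (radial_limsup_infinite (hatS0_fun g)) = 1%E]
  /\
  (space_S (0 : R) `<=` hatS0 /\
   first_category [set g : hatS0_type nu | space_S 0 (hatS0_fun g)]).
Proof.
split; last split.
- exists (\bigcap_n large_on_circle n) => [|g gl]; last first.
    apply: circle_measure_full => w cw; split=> //.
    exact: limsup_large_on_circle.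
  split.
    by exists (@large_on_circle R nu) => // n; exact: open_large_on_circle.
  move=> U U0 Uo; have [h Uh [j hj]] := lacunary_tail_dense nu_lt0 Uo U0.
  by exists h; split=> // n _; exact: lacunary_tail_large hj.
- exact: space_S0_sub.
- exists (@S0_ball R nu); last exact: space_S0_bigcup.
  by move=> i; exact: nowhere_dense_S0_ball.
Qed.
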